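(* Let $n$ be a positive integer and $\mu>2$. Then for every polynomial $p\in\mathbb{P}^2_n$, $$\|p\|_Q\le\frac{1}{\cos\frac{\pi}{\mu}}\min\{\|p\|_{\mathcal A_{\lceil\mu n\rceil}},\ \|p\|_{\mathcal B_{\lceil\mu n\rceil}},\ \|p\|_{MP_{\lceil 2\mu n\rceil}}\},$$ i.e. $\mathcal A_{\lceil\mu n\rceil}$, $\mathcal B_{\lceil\mu n\rceil}$, $MP_{\lceil 2\mu n\rceil}$ are optimal admissible meshes for $\mathbb{P}^2_n$ in $Q$. Moreover, for any set $S\subset Q$ of $\frac{(n+1)(n+2)}{2}$ points which is unisolvent for $\mathbb{P}^2_n$, $$\Lambda_n^S\le\frac{1}{\cos\frac{\pi}{\mu}}\min\{\|\lambda_n^S\|_{\mathcal A_{\lceil\mu n\rceil}},\ \|\lambda_n^S\|_{\mathcal B_{\lceil\mu n\rceil}},\ \|\lambda_n^S\|_{MP_{\lceil 2\mu n\rceil}}\}.$$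
   Context: $Q=[-1,1]^2$, $\mathbb{P}^2_n$ is the space of real bivariate polynomials of total degree at most $n$, and for a set $T\subset Q$ and a function $g$, $\|g\|_T=\sup_{T}|g|$. For a positive integer $\nu$, the Morrow-Patterson set is $MP_\nu=\{(\cos\frac{m\pi}{\nu+2},\cos\frac{j\pi}{\nu+3}) : 1\le m\le\nu+1,\ 1\le j\le\nu+2,\ m+j \text{ odd}\}$ (it has $\frac{(\nu+1)(\nu+2)}{2}$ points). Define $\mathcal A_\nu=MP_\nu\cup\{(1,1),(-1,1)\}$ if $\nu$ is even and $\mathcal A_\nu=MP_\nu\cup\{(1,1),(1,-1)\}$ if $\nu$ is odd; $\mathcal B_\nu=MP_\nu\cup\{(\cos\frac{\pi}{\nu+2},\cos\frac{\pi}{\nu+3}),(\cos\frac{(\nu+1)\pi}{\nu+2},\cos\frac{\pi}{\nu+3})\}$ if $\nu$ is even and $\mathcal B_\nu=MP_\nu\cup\{(\cos\frac{\pi}{\nu+2},\cos\frac{\pi}{\nu+3}),(\cos\frac{\pi}{\nu+2},\cos\frac{(\nu+2)\pi}{\nu+3})\}$ if $\nu$ is odd. For a unisolvent set $S$, $\lambda_n^S=\sum_{s\in S}|\ell_s|$ with $\ell_s\in\mathbb{P}^2_n$ the Lagrange basis polynomials ($\ell_s(t)=\delta_{st}$ for $s,t\in S$), and $\Lambda_n^S=\|\lambda_n^S\|_Q$ is the Lebesgue constant. $\lceil x\rceil$ denotes the ceiling. *)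

(* Defs.v *)
From Stdlib Require Import Reals Lra Lia ZArith List.
Import ListNotations.
Open Scope R_scope.

Definition pt := (R * R)%type.

Definition inQ (z : pt) : Prop :=
  -1 <= fst z <= 1 /\ -1 <= snd z <= 1.

Definition poly2 (n : nat) (f : pt -> R) : Prop :=
  exists c : nat -> nat -> R, forall x y : R,
    f (x, y) = sum_f_R0 (fun i => sum_f_R0 (fun j => c i j * x ^ i * y ^ j) (n - i)) n.

(* ceiling of a real number (Int_part is the floor) *)
Definition ceilZ (x : R) : Z := (- Int_part (- x))%Z.
Definition ceilN (x : R) : nat := Z.to_nat (ceilZ x).

Definition norm_on (L : list pt) (g : pt -> R) : R :=
  fold_right Rmax 0 (map (fun z => Rabs (g z)) L).

Definition MP (nu : nat) : list pt :=
  flat_map (fun m =>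
    map (fun j => (cos (INR m * PI / INR (nu + 2)), cos (INR j * PI / INR (nu + 3))))
      (filter (fun j => Nat.odd (m + j)) (seq 1 (nu + 2))))
    (seq 1 (nu + 1)).

Definition A_set (nu : nat) : list pt :=
  if Nat.even nu then MP nu ++ [(1, 1); (-1, 1)]
  else MP nu ++ [(1, 1); (1, -1)].

Definition B_set (nu : nat) : list pt :=
  let a := cos (PI / INR (nu + 2)) in
  let b := cos (PI / INR (nu + 3)) in
  if Nat.even nu then
    MP nu ++ [(a, b); (cos (INR (nu + 1) * PI / INR (nu + 2)), b)]
  else
    MP nu ++ [(a, b); (a, cos (INR (nu + 2) * PI / INR (nu + 3)))].

Definition dimP (n : nat) : nat := ((n + 1) * (n + 2) / 2)%nat.

Definition unisolvent (n : nat) (S : list pt) : Prop :=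
  length S = dimP n /\
  (forall p, poly2 n p -> (forall s, In s S -> p s = 0) -> forall z, p z = 0).

Definition lagrange_basis (n : nat) (S : list pt) (l : nat -> pt -> R) : Prop :=
  (forall i, (i < length S)%nat -> poly2 n (l i)) /\
  (forall i j, (i < length S)%nat -> (j < length S)%nat ->
     l i (nth j S (0, 0)) = if Nat.eqb i j then 1 else 0).

Definition lebesgue_fun (S : list pt) (l : nat -> pt -> R) (z : pt) : R :=
  fold_right Rplus 0 (map (fun i => Rabs (l i z)) (seq 0 (length S))).

(* Main.v *)
Require Import Defs.
From Stdlib Require Import Reals Lra Lia ZArith List.
Import ListNotations.
Open Scope R_scope.

(** In the angles [(a, b)] of [(cos a, cos b)], a polynomial of total degree [n]
    restricts to a trigonometric polynomial of degree [n] along the two diagonal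
    directions.  A trigonometric polynomial [T] of degree [n] with [|T| <= M] and
    [T t >= M cos phi] satisfies [T (t + s) >= M cos (phi + n s)] while
    [phi + n s < PI] (M. Riesz); this follows from interpolation at the [2n]
    extrema [x_k] of [cos (n x - beta)], where [beta = n t - phi],
<<
      sum_k (-1)^k T(x_k) cot((x_k - theta)/2)
        = - 2n (T(theta) / sin(n theta - beta) + r),    r independent of theta,
>>
    compared at [theta = t] and [theta = t + s] with the same identity for
    [cos (n x - beta)].  Two diagonal moves realise any displacement of angles at
    a cost equal to its sup norm, so starting near the supremum on the square, a
    mesh of covering radius [delta] in the angles captures it up to the factor
    [cos (n delta)].  The Lebesgue function is at each point the value of a
    polynomial that it dominates in absolute value everywhere. *)

(** * Trigonometric polynomials and restriction to the diagonals *)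

(** The free phase [c] supplies the sines, and [m = 0] the constants. [trig_ext] closes the class
    under pointwise equality, so no functional extensionality is needed. *)
Inductive trig (n : nat) : (R -> R) -> Prop :=
| trig_cos m c : (m <= n)%nat -> trig n (fun t => cos (INR m * t + c))
| trig_plus f g : trig n f -> trig n g -> trig n (fun t => f t + g t)
| trig_scal k f : trig n f -> trig n (fun t => k * f t)
| trig_ext f g : (forall t, f t = g t) -> trig n f -> trig n g.

Lemma trig_le n n' f : (n <= n')%nat -> trig n f -> trig n' f.
Proof.
intros le_n H; induction H as [m c Hm| | | f g Hfg _ IH].
- apply trig_cos; lia.
- now apply trig_plus.
- now apply trig_scal.
- now apply trig_ext with f.
Qed.

Lemma trig_sum n (f : nat -> R -> R) N :
  (forall i, (i <= N)%nat -> trig n (f i)) ->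
  trig n (fun t => sum_f_R0 (fun i => f i t) N).
Proof.
induction N as [|N IH]; intros H; simpl.
- apply trig_ext with (f 0%nat); auto.
- apply (trig_plus n (fun t => sum_f_R0 (fun i => f i t) N)); auto.
Qed.

(** Product-to-sum: frequency [m] splits into [m + 1] and [m - 1]. For [m = 0] the cosine is
    constant, and this case is separate because [m - 1] is not a natural number. *)
Lemma trig_mul_cos n f a :
  trig n f -> trig (S n) (fun t => f t * cos (t + a)).
Proof.
intros H; induction H as [m c Hm | f g _ IHf _ IHg | k f _ IH | f g Hfg _ IH].
- destruct m as [|m].
  + apply trig_ext with (fun t => cos c * cos (INR 1 * t + a)).
    * intros t; simpl; f_equal; f_equal; ring.
    * apply trig_scal, trig_cos; lia.
  + apply trig_ext with (fun t => / 2 * (cos (INR (S (S m)) * t + (c + a))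
                                    + cos (INR m * t + (c - a)))).
    * intros t; rewrite (form1 (_ + _)), !S_INR.
      replace ((_ - _) / 2) with (t + a) by field.
      replace ((_ + _) / 2) with ((INR m + 1) * t + c) by field.
      field.
    * apply trig_scal, (trig_plus _ (fun t => cos (INR (S (S m)) * t + (c + a))));
        apply trig_cos; lia.
- apply trig_ext with (fun t => f t * cos (t + a) + g t * cos (t + a)).
  + intros; ring.
  + now apply (trig_plus _ (fun t => f t * cos (t + a))).
- apply trig_ext with (fun t => k * (f t * cos (t + a))).
  + intros; ring.
  + now apply (trig_scal _ k (fun t => f t * cos (t + a))).
- apply trig_ext with (fun t => f t * cos (t + a)); trivial.
  intros t; now rewrite Hfg.
Qed.

Lemma trig_mul_cos_pow n f a k :
  trig n f -> trig (n + k) (fun t => f t * cos (t + a) ^ k).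
Proof.
intros H; induction k as [|k IH].
- rewrite Nat.add_0_r; apply trig_ext with f; trivial; intros; simpl; ring.
- rewrite Nat.add_succ_r.
  apply trig_ext with (fun t => f t * cos (t + a) ^ k * cos (t + a)).
  + intros; simpl; ring.
  + now apply (trig_mul_cos _ (fun t => f t * cos (t + a) ^ k)).
Qed.

(** The cosine is even, so [cos (a + s * t) = cos (t + s * a)] when [s] is a sign. A monomial of
    total degree [i + j <= n] becomes a product of [i + j] factors of degree one in [t]. *)
Lemma trig_diagonal n p (s s' a b : R) :
  poly2 n p -> s = 1 \/ s = -1 -> s' = 1 \/ s' = -1 ->
  trig n (fun t => p (cos (a + s * t), cos (b + s' * t))).
Proof.
intros [c Hp] Hs Hs'.
assert (cos_flip : forall r d t, r = 1 \/ r = -1 -> cos (d + r * t) = cos (t + r * d)).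
{ intros r d t [-> | ->]; [f_equal; ring|].
  rewrite <- cos_neg; f_equal; ring. }
apply trig_ext with (fun t => sum_f_R0 (fun i => sum_f_R0 (fun j =>
  c i j * (cos (t + s * a) ^ i * cos (t + s' * b) ^ j)) (n - i)) n).
{ intros t; rewrite Hp.
  apply sum_eq; intros i _; apply sum_eq; intros j _.
  rewrite (cos_flip s), (cos_flip s') by assumption; ring. }
apply (trig_sum n (fun i t => sum_f_R0 (fun j =>
  c i j * (cos (t + s * a) ^ i * cos (t + s' * b) ^ j)) (n - i))); intros i Hi.
apply (trig_sum n (fun j t =>
  c i j * (cos (t + s * a) ^ i * cos (t + s' * b) ^ j))); intros j Hj.
apply (trig_scal n (c i j) (fun t => cos (t + s * a) ^ i * cos (t + s' * b) ^ j)).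
apply trig_le with (0 + i + j)%nat; [lia|].
apply (trig_mul_cos_pow (0 + i) (fun t => cos (t + s * a) ^ i)).
(* The empty product, written as a cosine of frequency 0, starts the multiplication. *)
apply trig_ext with (fun t => cos (INR 0 * t + 0) * cos (t + s * a) ^ i).
- intros t; replace (INR 0 * t + 0) with 0 by (simpl; ring); rewrite cos_0; ring.
- apply (trig_mul_cos_pow 0 (fun t => cos (INR 0 * t + 0))), trig_cos; lia.
Qed.

(** * Interpolation at the extrema of a cosine *)

Definition node (n : nat) (beta : R) (k : nat) : R := (beta + INR k * PI) / INR n.

Definition cot (x : R) : R := cos x / sin x.

Lemma sin_plus_INR_PI k x : sin (x + INR k * PI) = (-1) ^ k * sin x.
Proof.
induction k as [|k IH].
- simpl; rewrite Rmult_0_l, Rplus_0_r; ring.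
- rewrite S_INR; replace (x + (INR k + 1) * PI) with (x + INR k * PI + PI) by ring.
  rewrite neg_sin, IH; simpl; ring.
Qed.

Lemma cos_plus_INR_PI k x : cos (x + INR k * PI) = (-1) ^ k * cos x.
Proof.
rewrite <- !sin_shift.
replace (PI / 2 - (x + INR k * PI)) with (PI / 2 + (- x) - INR k * PI) by ring.
assert (H := sin_plus_INR_PI k (PI / 2 + (- x) - INR k * PI)).
replace (PI / 2 + - x - INR k * PI + INR k * PI) with (PI / 2 - x) in H by ring.
rewrite H, <- Rmult_assoc, <- Rdef_pow_add.
replace (k + k)%nat with (2 * k)%nat by lia.
rewrite pow_1_even; ring.
Qed.

Lemma sign_sqr k : (-1) ^ k * (-1) ^ k = 1.
Proof.
rewrite <- Rdef_pow_add; replace (k + k)%nat with (2 * k)%nat by lia; apply pow_1_even.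
Qed.

(** Product-to-sum turns each term into a telescoping difference. *)
Lemma sum_sin_arith d w N :
  2 * sin (w / 2) * sum_f_R0 (fun k => sin (INR k * w + d)) N =
  cos (d - w / 2) - cos (INR (S N) * w + d - w / 2).
Proof.
assert (step : forall x, 2 * sin (w / 2) * sin x = cos (x - w / 2) - cos (x + w / 2)).
{ intros x; rewrite cos_minus, cos_plus; ring. }
induction N as [|N IH].
- simpl sum_f_R0; rewrite step; simpl INR; f_equal; f_equal; field.
- rewrite tech5, Rmult_plus_distr_l, IH, step.
  rewrite !S_INR.
  replace ((INR N + 1) * w + d + w / 2) with ((INR N + 1 + 1) * w + d - w / 2) by field.
  ring.
Qed.

(** The sign is absorbed as a shift by [k * PI], which leaves sines in arithmetic progression with
    step [w]. After [2 * n] steps the angle has advanced by whole turns, so the telescoped sum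
    vanishes; [m < n] keeps [w / 2] inside the open interval from 0 to [PI]. *)
Lemma alternating_sin_sum n m beta c :
  (m < n)%nat ->
  sum_f_R0 (fun k => (-1) ^ k * sin (INR m * node n beta k + c)) (2 * n - 1) = 0.
Proof.
intros Hm.
assert (Hn : 0 < INR n) by (apply lt_0_INR; lia).
assert (Hmn : INR m < INR n) by now apply lt_INR.
assert (Hm0 := pos_INR m).
set (w := PI * (INR m + INR n) / INR n).
set (d := INR m * beta / INR n + c).
assert (sw : 0 < sin (w / 2)).
{ assert (HPI := PI_RGT_0).
  replace (w / 2) with (PI * ((INR m + INR n) / (2 * INR n))) by (unfold w; field; lra).
  assert (0 < (INR m + INR n) / (2 * INR n)) by (apply Rdiv_lt_0_compat; lra).
  assert ((INR m + INR n) / (2 * INR n) < 1)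
    by (apply Rmult_lt_reg_r with (2 * INR n); [lra|];
        unfold Rdiv; rewrite Rmult_assoc, Rinv_l; lra).
  apply sin_gt_0; nra. }
rewrite sum_eq with (Bn := fun k => sin (INR k * w + d)).
2:{ intros k _; rewrite <- sin_plus_INR_PI; unfold node, w, d; f_equal; field; lra. }
apply Rmult_eq_reg_l with (2 * sin (w / 2)); [|lra].
rewrite sum_sin_arith.
replace (S (2 * n - 1)) with (2 * n)%nat by lia.
replace (INR (2 * n) * w + d - w / 2) with (d - w / 2 + 2 * INR (m + n) * PI).
- rewrite cos_period; ring.
- rewrite mult_INR, plus_INR; unfold w; simpl (INR 2); field; lra.
Qed.

(** The hypothesis puts [theta] strictly between nodes 0 and 1. Node 0 is just behind it, and all
    the others lie ahead by less than a full turn. *)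
Lemma sin_half_node n beta theta k :
  (k < 2 * n)%nat -> 0 < INR n * theta - beta < PI ->
  if Nat.eqb k 0 then sin ((node n beta k - theta) / 2) < 0
  else 0 < sin ((node n beta k - theta) / 2).
Proof.
intros Hk Htheta.
assert (Hn : 1 <= INR n) by (change 1 with (INR 1); apply le_INR; lia).
assert (HPI := PI_RGT_0).
set (u := (INR k * PI - (INR n * theta - beta)) / (2 * INR n)).
assert (Hu : u * (2 * INR n) = INR k * PI - (INR n * theta - beta))
  by (unfold u; field; lra).
replace ((node n beta k - theta) / 2) with u by (unfold u, node; field; lra).
destruct k as [|k]; simpl Nat.eqb; cbv iota.
- simpl INR in Hu; apply sin_lt_0_var; nra.
- assert (Hk0 := pos_INR k).
  assert (INR (S k) + 1 <= 2 * INR n).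
  { rewrite <- S_INR; change 2 with (INR 2); rewrite <- mult_INR; apply le_INR; lia. }
  rewrite S_INR in *.
  apply sin_gt_0; nra.
Qed.

(** With [h = s / 2], the difference [cos (y + h) - cos (y - h)] has the factor [sin h], which
    cancels the denominator of [cot h]. Raising the frequency thus changes a cotangent sum by sine
    sums only. *)
Lemma cos_succ_mul_cot m s c :
  sin (s / 2) <> 0 ->
  cos (INR (S m) * s + c) * cot (s / 2) =
  cos (INR m * s + c) * cot (s / 2)
  - (sin (INR (S m) * s + c) + sin (INR m * s + c)).
Proof.
intros Hs; rewrite S_INR.
set (y := INR m * s + c + s / 2).
replace ((INR m + 1) * s + c) with (y + s / 2) by (unfold y; field).
replace (INR m * s + c) with (y - s / 2) by (unfold y; field).
rewrite cos_plus, cos_minus, sin_plus, sin_minus; unfold cot; field; trivial.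
Qed.

Lemma sum_f_R0_const_eq f c N :
  (forall k, (k <= N)%nat -> f k = c) -> sum_f_R0 f N = INR (S N) * c.
Proof.
intros Hf; rewrite sum_eq with (Bn := fun _ => c) by trivial.
rewrite sum_cte; ring.
Qed.

Section CotangentSums.
Variables (n : nat) (beta theta : R).
Hypothesis n_gt0 : (0 < n)%nat.
Hypothesis theta_range : 0 < INR n * theta - beta < PI.

Let s k := node n beta k - theta.
Let F m c := sum_f_R0 (fun k => (-1) ^ k * cos (INR m * s k + c) * cot (s k / 2)) (2 * n - 1).
Let G m c := sum_f_R0 (fun k => (-1) ^ k * sin (INR m * s k + c)) (2 * n - 1).

Lemma cot_sum_succ m c : F (S m) c = F m c - (G (S m) c + G m c).
Proof using n_gt0 theta_range.
unfold F, G; rewrite <- plus_sum, <- minus_sum.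
apply sum_eq; intros k Hk.
assert (Hsin : sin (s k / 2) <> 0).
{ assert (H := sin_half_node n beta theta k ltac:(lia) theta_range).
  fold (s k) in H; destruct (Nat.eqb k 0); lra. }
rewrite !Rmult_assoc, cos_succ_mul_cot by trivial; ring.
Qed.

Lemma sin_sum_lt m c : (m < n)%nat -> G m c = 0.
Proof using n_gt0.
intros Hm; rewrite <- (alternating_sin_sum n m beta (c - INR m * theta)) by trivial.
apply sum_eq; intros k _; unfold s; do 2 f_equal; ring.
Qed.

Lemma angle_top k c :
  INR n * s k + c = beta - INR n * theta + c + INR k * PI.
Proof using n_gt0.
assert (0 < INR n) by now apply lt_0_INR.
unfold s, node; field; lra.
Qed.

(** At frequency [n] the sines alternate exactly as the weights do, so all [2 * n] terms agree. *)
Lemma sin_sum_top c : G n c = 2 * INR n * sin (beta - INR n * theta + c).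
Proof using n_gt0.
unfold G; rewrite sum_f_R0_const_eq with (c := sin (beta - INR n * theta + c)).
- replace (S (2 * n - 1)) with (2 * n)%nat by lia.
  rewrite mult_INR; simpl (INR 2); ring.
- intros k _; rewrite angle_top, sin_plus_INR_PI, <- Rmult_assoc, sign_sqr; ring.
Qed.

(** The recurrence only subtracts sine sums of frequency below [n], which are zero, so [F] does not
    depend on [m] here. At frequency 0 the phase factors out. *)
Lemma cot_sum_lt m c : (m < n)%nat -> F m c = cos c * F 0 0.
Proof using n_gt0 theta_range.
induction m as [|m IH]; intros Hm.
- unfold F; rewrite scal_sum; apply sum_eq; intros k _.
  simpl INR; rewrite !Rmult_0_l, Rplus_0_l, Rplus_0_l, cos_0; ring.
- rewrite cot_sum_succ, IH, !sin_sum_lt by lia; ring.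
Qed.

Lemma cot_sum_top c :
  F n c = cos c * F 0 0 - 2 * INR n * sin (beta - INR n * theta + c).
Proof using n_gt0 theta_range.
rewrite <- sin_sum_top.
replace n with (S (n - 1)) at 1 2 by lia.
rewrite cot_sum_succ, cot_sum_lt, (sin_sum_lt (n - 1)) by lia; ring.
Qed.

(* The frequency [n] in quadrature with the nodes vanishes at all of them. *)
Lemma cot_sum_zero : F 0 0 = - (2 * INR n) / sin (INR n * theta - beta).
Proof using n_gt0 theta_range.
assert (Hsin : 0 < sin (INR n * theta - beta)) by (apply sin_gt_0; lra).
assert (H := cot_sum_top (INR n * theta - beta + PI / 2)).
replace (F n _) with 0 in H.
- replace (beta - _ + _) with (PI / 2) in H by ring.
  replace (INR n * theta - beta + PI / 2) with (PI / 2 + (INR n * theta - beta)) in H by ring.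
  assert (Hcos := sin_cos (INR n * theta - beta)).
  replace (cos (PI / 2 + _)) with (- sin (INR n * theta - beta)) in H by lra.
  rewrite sin_PI2 in H.
  apply Rmult_eq_reg_r with (sin (INR n * theta - beta)); [|lra].
  unfold Rdiv; rewrite Rmult_assoc, Rinv_l; lra.
- unfold F; rewrite sum_f_R0_const_eq with (c := 0); [ring|].
  intros k _; rewrite angle_top, cos_plus_INR_PI.
  replace (beta - _ + _) with (PI / 2) by ring.
  rewrite cos_PI2; ring.
Qed.

(** Measuring angles from [theta] turns the phase into [m * theta + c]. Only the top frequency
    leaves a remainder, and [theta] cancels in it. *)
Lemma cot_interpolation_cos m c :
  (m <= n)%nat ->
  sum_f_R0 (fun k => (-1) ^ k * cos (INR m * node n beta k + c)
                     * cot ((node n beta k - theta) / 2)) (2 * n - 1) =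
  - (2 * INR n) * (cos (INR m * theta + c) / sin (INR n * theta - beta)
                   + if Nat.eqb m n then sin (beta + c) else 0).
Proof using n_gt0 theta_range.
intros Hm.
assert (Hsin : 0 < sin (INR n * theta - beta)) by (apply sin_gt_0; lra).
transitivity (F m (INR m * theta + c)).
{ apply sum_eq; intros k _; unfold s; do 3 f_equal; ring. }
destruct (Nat.eqb_spec m n) as [-> | Hneq].
- rewrite cot_sum_top, cot_sum_zero.
  replace (beta - _ + _) with (beta + c) by ring; field; lra.
- rewrite cot_sum_lt, cot_sum_zero by lia; field; lra.
Qed.

End CotangentSums.

Lemma cot_interpolation n T beta :
  (0 < n)%nat -> trig n T ->
  exists r, forall theta, 0 < INR n * theta - beta < PI ->
    sum_f_R0 (fun k => (-1) ^ k * T (node n beta k)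
                       * cot ((node n beta k - theta) / 2)) (2 * n - 1) =
    - (2 * INR n) * (T theta / sin (INR n * theta - beta) + r).
Proof.
intros Hn HT; induction HT as [m c Hm | f g _ [r IHf] _ [r' IHg] | a f _ [r IH] | f g Hfg _ [r IH]].
- eexists; intros theta Htheta; now apply cot_interpolation_cos.
- exists (r + r'); intros theta Htheta.
  transitivity (- (2 * INR n) * (f theta / sin (INR n * theta - beta) + r)
                + - (2 * INR n) * (g theta / sin (INR n * theta - beta) + r'));
    [|unfold Rdiv; ring].
  rewrite <- IHf, <- IHg, <- plus_sum by trivial.
  apply sum_eq; intros; ring.
- exists (a * r); intros theta Htheta.
  transitivity (a * (- (2 * INR n) * (f theta / sin (INR n * theta - beta) + r)));
    [|unfold Rdiv; ring].
  rewrite <- IH, scal_sum by trivial.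
  apply sum_eq; intros; ring.
- exists r; intros theta Htheta; rewrite <- Hfg, <- IH by trivial.
  apply sum_eq; intros; now rewrite Hfg.
Qed.

(** * The Riesz comparison with a cosine *)

(** [cot x' - cot x = sin (x - x') / (sin x * sin x')], and the two sines in the denominator have
    the same sign because no node lies between [t] and [t']. *)
Lemma cot_half_node_decr n beta t t' k :
  (k < 2 * n)%nat -> t <= t' ->
  0 < INR n * t - beta < PI -> 0 < INR n * t' - beta < PI ->
  cot ((node n beta k - t) / 2) <= cot ((node n beta k - t') / 2).
Proof.
intros Hk Htt' Ht Ht'.
assert (Hn : 1 <= INR n) by (change 1 with (INR 1); apply le_INR; lia).
assert (HPI := PI_RGT_0).
assert (t' - t < PI) by nra.
set (x := (node n beta k - t) / 2); set (x' := (node n beta k - t') / 2).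
assert (Hprod : 0 < sin x * sin x').
{ assert (Hx := sin_half_node n beta t k Hk Ht).
  assert (Hx' := sin_half_node n beta t' k Hk Ht').
  fold x in Hx; fold x' in Hx'; destruct (Nat.eqb k 0); nra. }
assert (Hd : 0 <= sin (x - x')).
{ replace (x - x') with ((t' - t) / 2) by (unfold x, x'; field).
  apply sin_ge_0; lra. }
rewrite sin_minus in Hd.
apply Rminus_le; apply Ropp_le_cancel; rewrite Ropp_0, Ropp_minus_distr.
replace (cot x' - cot x) with ((sin x * cos x' - cos x * sin x') / (sin x * sin x')).
- apply Rmult_le_pos; [trivial | left; now apply Rinv_0_lt_compat].
- unfold cot; field; split; intros H0; rewrite H0 in Hprod; lra.
Qed.

Lemma trig_lower_bound n T M phi t s :
  (0 < n)%nat -> trig n T -> (forall x, Rabs (T x) <= M) ->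
  0 < phi -> 0 <= s -> phi + INR n * s < PI ->
  M * cos phi <= T t -> M * cos (phi + INR n * s) <= T (t + s).
Proof.
intros Hn HT HM Hphi Hs Hpi Ht.
assert (Hn' : 0 < INR n) by now apply lt_0_INR.
set (beta := INR n * t - phi).
assert (E0 : INR n * t - beta = phi) by (unfold beta; ring).
assert (E1 : INR n * (t + s) - beta = phi + INR n * s) by (unfold beta; ring).
assert (R0 : 0 < INR n * t - beta < PI) by nra.
assert (R1 : 0 < INR n * (t + s) - beta < PI) by nra.
assert (S0 : 0 < sin phi) by (apply sin_gt_0; nra).
assert (S1 : 0 < sin (phi + INR n * s)) by (apply sin_gt_0; nra).
destruct (cot_interpolation n T beta Hn HT) as [r Hr].
destruct (cot_interpolation n (fun x => cos (INR n * x + - beta)) beta Hn) as [r' Hr'].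
{ apply trig_cos; lia. }
assert (Hr0 := Hr t R0); assert (Hr1 := Hr _ R1).
assert (Hr0' := Hr' t R0); assert (Hr1' := Hr' _ R1).
fold (INR n * t - beta) in Hr0'; fold (INR n * (t + s) - beta) in Hr1'.
rewrite E0 in *; rewrite E1 in *.
(* Termwise comparison: the cotangent increments are nonnegative, and [M * cos (n x - beta)] takes
   the extreme value [(-1) ^ k * M] at node [k]. *)
assert (key :
  sum_f_R0 (fun k => (-1) ^ k * T (node n beta k) * cot ((node n beta k - (t + s)) / 2)) (2 * n - 1)
  - sum_f_R0 (fun k => (-1) ^ k * T (node n beta k) * cot ((node n beta k - t) / 2)) (2 * n - 1)
  <= M *
  (sum_f_R0 (fun k => (-1) ^ k * cos (INR n * node n beta k + - beta) * cot ((node n beta k - (t + s)) / 2)) (2 * n - 1)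
  - sum_f_R0 (fun k => (-1) ^ k * cos (INR n * node n beta k + - beta) * cot ((node n beta k - t) / 2)) (2 * n - 1))).
{ rewrite <- !minus_sum, scal_sum.
  apply sum_Rle; intros k Hk.
  assert (Hcot := cot_half_node_decr n beta t (t + s) k ltac:(lia) ltac:(lra)
                    ltac:(rewrite E0; lra) ltac:(rewrite E1; lra)).
  replace (INR n * node n beta k + - beta) with (0 + INR k * PI)
    by (unfold node; field; lra).
  rewrite cos_plus_INR_PI, cos_0, Rmult_1_r, sign_sqr.
  assert (HTk : (-1) ^ k * T (node n beta k) <= M).
  { apply Rle_trans with (2 := HM (node n beta k)).
    apply Rle_trans with (1 := Rle_abs _).
    rewrite Rabs_mult, pow_1_abs; lra. }
  nra. }
(* The remainders [r] and [r'] cancel in the differences, and the factor [- (2 * INR n)] reverses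
   the inequality. *)
rewrite Hr0, Hr1, Hr0', Hr1' in key.
assert (T t / sin phi >= M * (cos phi / sin phi)).
{ apply Rle_ge; unfold Rdiv; rewrite <- Rmult_assoc.
  apply Rmult_le_compat_r; [left; now apply Rinv_0_lt_compat | trivial]. }
assert (M * (cos (phi + INR n * s) / sin (phi + INR n * s)) <= T (t + s) / sin (phi + INR n * s)) by nra.
apply Rmult_le_reg_r with (/ sin (phi + INR n * s)); [now apply Rinv_0_lt_compat|].
unfold Rdiv in *; lra.
Qed.

(** * Propagation of lower bounds in the square *)

Lemma poly2_diagonal_bound n p M a b phi u s' :
  (0 < n)%nat -> poly2 n p -> (forall z, inQ z -> Rabs (p z) <= M) ->
  s' = 1 \/ s' = -1 ->
  0 < phi -> phi + INR n * Rabs u < PI ->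
  M * cos phi <= p (cos a, cos b) ->
  M * cos (phi + INR n * Rabs u) <= p (cos (a + u), cos (b + s' * u)).
Proof.
intros Hn Hp HM Hs' Hphi Hpi H0.
(* The trigonometric bound only moves forwards, so the sign of [u] goes into the orientation of the
   diagonal. *)
assert (exists s, (s = 1 \/ s = -1) /\ u = s * Rabs u) as [s [Hs Hu]].
{ unfold Rabs; destruct (Rcase_abs u); [exists (-1) | exists 1]; split; auto; ring. }
assert (Hss : s' * s = 1 \/ s' * s = -1)
  by (destruct Hs as [-> | ->], Hs' as [-> | ->]; lra).
assert (HT := trig_diagonal n p s (s' * s) a b Hp Hs Hss).
assert (H := trig_lower_bound n _ M phi 0 (Rabs u) Hn HT).
cbv beta in H; rewrite !Rmult_0_r, !Rplus_0_r, Rplus_0_l, Rmult_assoc, <- Hu in H.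
apply H; trivial; [|apply Rabs_pos].
intros x; apply HM; split; apply COS_bound.
Qed.

(* Every displacement in the angles is a sum of two diagonal ones, [(w, w)] and
   [(w', -w')], with [|w| + |w'|] the sup norm of the displacement. *)
Lemma poly2_angle_bound n p M a b a' b' phi delta :
  (0 < n)%nat -> poly2 n p -> (forall z, inQ z -> Rabs (p z) <= M) ->
  Rabs (a' - a) <= delta -> Rabs (b' - b) <= delta ->
  0 < phi -> phi + INR n * delta < PI ->
  M * cos phi <= p (cos a, cos b) ->
  M * cos (phi + INR n * delta) <= p (cos a', cos b').
Proof.
intros Hn Hp HM Ha Hb Hphi Hpi H0.
assert (Hn' : 0 < INR n) by now apply lt_0_INR.
set (w := ((a' - a) + (b' - b)) / 2); set (w' := ((a' - a) - (b' - b)) / 2).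
assert (Hw : Rabs w + Rabs w' <= delta).
{ revert Ha Hb; unfold w, w', Rabs; repeat destruct Rcase_abs; lra. }
assert (Hnw : 0 <= INR n * Rabs w) by (apply Rmult_le_pos; [lra | apply Rabs_pos]).
assert (Hnw' : 0 <= INR n * Rabs w') by (apply Rmult_le_pos; [lra | apply Rabs_pos]).
apply (Rmult_le_compat_l (INR n)) in Hw; [|lra].
rewrite Rmult_plus_distr_l in Hw.
assert (M0 : 0 <= M).
{ apply Rle_trans with (1 := Rabs_pos (p (0, 0))); apply HM; split; simpl; lra. }
assert (H1 := poly2_diagonal_bound n p M a b phi w 1 Hn Hp HM ltac:(lra) Hphi
                ltac:(lra) H0).
(* The intermediate angles may leave the range from 0 to [PI]; their cosines still give a point of
   the square. *)
assert (H2 := poly2_diagonal_bound n p M _ _ (phi + INR n * Rabs w) w' (-1) Hn Hp HM ltac:(lra)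
                ltac:(lra) ltac:(lra) H1).
replace (a + w + w') with a' in H2 by (unfold w, w'; field).
replace (b + 1 * w + -1 * w') with b' in H2 by (unfold w, w'; field).
(* The two moves may cost less than [delta]; the cosine decreases up to [PI]. *)
apply Rle_trans with (2 := H2).
apply Rmult_le_compat_l; [trivial|].
apply cos_decr_1; lra.
Qed.

(** * Functions touched from below by polynomials *)

(** This treats [|p|] and the Lebesgue function alike: propagation from a near-maximal point only
    needs one polynomial that equals [f] there and is dominated by [f] everywhere. *)
Definition poly_envelope (n : nat) (f : pt -> R) : Prop :=
  forall z0, exists p, poly2 n p /\ p z0 = f z0 /\ forall z, Rabs (p z) <= f z.

Lemma poly_envelope_zero n : poly_envelope n (fun _ => 0).
Proof.
intros z0; exists (fun _ => 0); split; [|split; [trivial|]].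
- exists (fun _ _ => 0); intros x y; symmetry.
  rewrite sum_eq with (Bn := fun _ => 0); [apply sum_eq_R0; trivial|].
  intros i _; apply sum_eq_R0; intros; ring.
- intros _; rewrite Rabs_R0; lra.
Qed.

Lemma poly2_lincomb n p q k :
  poly2 n p -> poly2 n q -> poly2 n (fun z => k * p z + q z).
Proof.
intros [c Hc] [d Hd]; exists (fun i j => k * c i j + d i j); intros x y.
rewrite Hc, Hd, scal_sum, <- plus_sum.
apply sum_eq; intros i _; rewrite Rmult_comm, scal_sum, <- plus_sum.
apply sum_eq; intros j _; ring.
Qed.

(** The sign of [p z0] is fixed as a constant factor: this gives equality at [z0] and the triangle
    inequality elsewhere. *)
Lemma poly_envelope_add_abs n p f :
  poly2 n p -> poly_envelope n f -> poly_envelope n (fun z => Rabs (p z) + f z).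
Proof.
intros Hp Hf z0; destruct (Hf z0) as [q [Hq [Hq0 Hqf]]].
assert (exists k, Rabs k = 1 /\ Rabs (p z0) = k * p z0) as [k [Hk Hk0]].
{ unfold Rabs at 2; destruct (Rcase_abs (p z0)); [exists (-1) | exists 1];
    split; try ring; unfold Rabs; destruct Rcase_abs; lra. }
exists (fun z => k * p z + q z); split; [now apply poly2_lincomb|split].
- now rewrite Hk0, Hq0.
- intros z; apply Rle_trans with (1 := Rabs_triang _ _).
  rewrite Rabs_mult, Hk, Rmult_1_l; specialize (Hqf z); lra.
Qed.

Lemma poly2_bounded n p :
  poly2 n p -> exists B, forall z, inQ z -> Rabs (p z) <= B.
Proof.
intros [c Hc].
exists (sum_f_R0 (fun i => sum_f_R0 (fun j => Rabs (c i j)) (n - i)) n).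
intros [x y] [Hx Hy]; simpl in Hx, Hy; rewrite Hc.
assert (Hpow : forall t i, -1 <= t <= 1 -> Rabs (t ^ i) <= 1).
{ intros t i Ht; rewrite <- RPow_abs, <- (pow1 i).
  apply pow_incr; split; [apply Rabs_pos | now apply Rabs_le]. }
apply Rle_trans with (1 := Rsum_abs _ _); apply sum_Rle; intros i _.
apply Rle_trans with (1 := Rsum_abs _ _); apply sum_Rle; intros j _.
rewrite !Rabs_mult.
assert (H1 := Hpow x i Hx); assert (H2 := Hpow y j Hy).
assert (P0 := Rabs_pos (c i j)); assert (P1 := Rabs_pos (x ^ i)).
assert (P2 := Rabs_pos (y ^ j)).
assert (Rabs (c i j) * Rabs (x ^ i) <= Rabs (c i j)) by nra; nra.
Qed.

Lemma norm_on_ge L g z : In z L -> Rabs (g z) <= norm_on L g.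
Proof.
induction L as [|z' L IH]; simpl; [tauto|].
unfold norm_on; simpl; intros [-> | H]; [apply Rmax_l|].
apply Rle_trans with (2 := Rmax_r _ _); now apply IH.
Qed.

Lemma norm_on_pos L g : 0 <= norm_on L g.
Proof.
induction L as [|z L IH]; [apply Rle_refl|].
apply Rle_trans with (1 := IH), Rmax_r.
Qed.

(** * From angular coverings to norm bounds *)

Definition angle_covering (delta : R) (L : list pt) : Prop :=
  forall a b, 0 <= a <= PI -> 0 <= b <= PI ->
  exists a' b', In (cos a', cos b') L /\ Rabs (a' - a) <= delta /\ Rabs (b' - b) <= delta.

(** The propagation lemma requires a strictly positive initial phase. A point where [f] exceeds
    [M * cos eps], with [M] the supremum, therefore suffices: the mesh sees at least
    [M * cos (eps + n delta)], and [eps] tends to 0. The maximum need not be attained. *)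
Lemma angle_covering_bound n f delta L :
  (0 < n)%nat -> poly_envelope n f ->
  (exists B, forall z, inQ z -> f z <= B) ->
  angle_covering delta L -> 0 <= delta -> INR n * delta < PI / 2 ->
  forall z, inQ z -> f z <= / cos (INR n * delta) * norm_on L f.
Proof.
intros Hn Hf [B HB] HL Hdelta Hnd.
assert (HPI := PI_RGT_0).
assert (Hn' : 0 < INR n) by now apply lt_0_INR.
assert (Hcos : 0 < cos (INR n * delta)) by (apply cos_gt_0; nra).
assert (Hf0 : forall z, 0 <= f z).
{ intros z; destruct (Hf z) as [p [_ [_ Hp]]].
  apply Rle_trans with (2 := Hp z), Rabs_pos. }
assert (Q0 : inQ (0, 0)) by (split; simpl; lra).
destruct (completeness (fun y => exists z, inQ z /\ y = f z)) as [M [HM Hlub]].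
- exists B; intros y [z [Hz ->]]; now apply HB.
- exists (f (0, 0)), (0, 0); auto.
- assert (HfM : forall z, inQ z -> f z <= M) by (intros z Hz; apply HM; eauto).
  assert (M0 : 0 <= M) by (apply Rle_trans with (2 := HfM _ Q0); trivial).
  enough (M * cos (INR n * delta) <= norm_on L f).
  { intros z Hz; apply Rle_trans with (1 := HfM z Hz).
    apply Rmult_le_reg_r with (cos (INR n * delta)); trivial.
    rewrite (Rmult_comm (/ _)), Rmult_assoc, Rinv_l; lra. }
  destruct M0 as [M0 | <-]; [|rewrite Rmult_0_l; apply norm_on_pos].
  assert (Heps : forall eps, 0 < eps < PI / 2 ->
            M * cos (eps + INR n * delta) <= norm_on L f).
  { intros eps Heps.
    assert (cos eps < 1) by (rewrite <- cos_0; apply cos_decreasing_1; lra).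
    assert (exists z, inQ z /\ M * cos eps < f z) as [[x y] [Hz Hfz]].
    { apply Classical_Prop.NNPP; intros Hne.
      assert (M <= M * cos eps); [|nra].
      apply Hlub; intros y [z [Hz ->]].
      apply Rnot_lt_le; intros Hlt; apply Hne; eauto. }
    destruct (Hf (x, y)) as [p [Hp [Hpz Hpf]]].
    assert (Hpz' := Hpz); rewrite <- Hpz in Hfz.
    destruct Hz as [Hx Hy]; simpl in Hx, Hy.
    destruct (HL (acos x) (acos y)) as [a' [b' [Hin [Ha Hb]]]]; try apply acos_bound.
    apply Rle_trans with (2 := norm_on_ge L f _ Hin).
    apply Rle_trans with (2 := Rle_abs _).
    apply Rle_trans with (2 := Hpf _).
    apply Rle_trans with (2 := Rle_abs _).
    apply poly2_angle_bound with (acos x) (acos y); trivial; try nra.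
    - intros z Hz; apply Rle_trans with (1 := Hpf z); auto.
    - rewrite !cos_acos by trivial; lra. }
  apply Rnot_lt_le; intros Hlt.
  destruct (continuity_cos (INR n * delta)
              ((M * cos (INR n * delta) - norm_on L f) / M)) as [eta [Heta Hc]].
  { apply Rdiv_lt_0_compat; lra. }
  (* The first bound stays strictly inside the continuity window, the second meets the restriction
     in [Heps]. *)
  set (eps := Rmin (eta / 2) (PI / 4)).
  assert (0 < eps) by (apply Rmin_glb_lt; lra).
  assert (eps <= eta / 2) by apply Rmin_l.
  assert (eps <= PI / 4) by apply Rmin_r.
  assert (He := Heps eps ltac:(lra)).
  assert (Hd : Rabs (cos (eps + INR n * delta) - cos (INR n * delta)) <
               (M * cos (INR n * delta) - norm_on L f) / M).
  { apply Hc; split; [split; [exact I | lra]|].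
    simpl; unfold Rdist; apply Rabs_def1; lra. }
  apply Rabs_def2 in Hd; destruct Hd as [_ Hd].
  apply (Rmult_lt_compat_l M) in Hd; trivial.
  replace (M * - (_ / M)) with (norm_on L f - M * cos (INR n * delta)) in Hd by (field; lra).
  lra.
Qed.

(** * Covering radii of the Morrow-Patterson meshes *)

Definition ang (N m : nat) : R := INR m * PI / INR N.

Lemma in_MP nu m j :
  (1 <= m <= nu + 1)%nat -> (1 <= j <= nu + 2)%nat -> Nat.Odd (m + j) ->
  In (cos (ang (nu + 2) m), cos (ang (nu + 3) j)) (MP nu).
Proof.
intros Hm Hj Hodd; apply in_flat_map; exists m; split; [apply in_seq; lia|].
apply (in_map (fun j => (cos (ang (nu + 2) m), cos (ang (nu + 3) j)))).
apply filter_In; split; [apply in_seq; lia | now apply Nat.odd_spec].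
Qed.

Lemma ang_cell N a :
  (0 < N)%nat -> 0 <= a <= PI ->
  exists m, (m < N)%nat /\ ang N m <= a <= ang N (S m).
Proof.
intros HN Ha.
enough (H : forall k, (0 < k <= N)%nat -> a <= ang N k ->
          exists m, (m < N)%nat /\ ang N m <= a <= ang N (S m)).
{ apply (H N); [lia|].
  assert (0 < INR N) by now apply lt_0_INR.
  unfold ang; replace (INR N * PI / INR N) with PI by (field; lra); lra. }
intros k; induction k as [|k IH]; intros Hk Hak; [lia|].
destruct (Rle_lt_dec (ang N k) a) as [H|H].
- exists k; split; [lia | split; trivial].
- apply IH; [|lra].
  destruct k; [|lia].
  unfold ang in H; simpl in H; unfold Rdiv in H; rewrite !Rmult_0_l in H; lra.
Qed.

(** Index [k] is at most [d] steps above the lower end of the cell and at most [d] below its upper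
    end; sums avoid truncated subtraction. *)
Lemma ang_dist N m k d a :
  (0 < N)%nat -> ang N m <= a <= ang N (S m) ->
  (k <= m + d)%nat -> (m + 1 <= k + d)%nat ->
  Rabs (ang N k - a) <= INR d * PI / INR N.
Proof.
intros HN Ha H1 H2.
assert (HNr : 0 < / INR N) by now apply Rinv_0_lt_compat, lt_0_INR.
assert (HPI := PI_RGT_0).
assert (Hpos : 0 < PI * / INR N) by now apply Rmult_lt_0_compat.
unfold ang, Rdiv in *; rewrite !Rmult_assoc in *.
apply le_INR in H1, H2; rewrite !plus_INR in *; rewrite S_INR in Ha; simpl (INR 1) in H2.
apply Rabs_le; nra.
Qed.

Lemma step_le N d nu :
  (0 < nu)%nat -> (nu <= N)%nat -> INR d * PI / INR N <= INR d * PI / INR nu.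
Proof.
intros Hnu HN.
apply Rmult_le_compat_l.
- apply Rmult_le_pos; [apply pos_INR | left; apply PI_RGT_0].
- apply Rinv_le_contravar; [now apply lt_0_INR | now apply le_INR].
Qed.

(** Covering reduces to a finite check on grid cells: the first index is a vertex of the cell, and
    only the second may reach further, up to [d] steps. Both step sizes are relaxed to
    [PI / INR nu]. *)
Lemma angle_covering_grid nu d L :
  (0 < nu)%nat -> (1 <= d)%nat ->
  (forall m j, (m <= nu + 1)%nat -> (j <= nu + 2)%nat ->
    exists m' j', (m <= m' <= m + 1)%nat /\ (j + 1 <= j' + d /\ j' <= j + d)%nat /\
      In (cos (ang (nu + 2) m'), cos (ang (nu + 3) j')) L) ->
  angle_covering (INR d * PI / INR nu) L.
Proof.
intros Hnu Hd HL a b Ha Hb.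
destruct (ang_cell (nu + 2) a) as [m [Hm Ham]]; [lia | trivial |].
destruct (ang_cell (nu + 3) b) as [j [Hj Hbj]]; [lia | trivial |].
destruct (HL m j) as [m' [j' [Hm' [Hj' Hin]]]]; [lia | lia |].
exists (ang (nu + 2) m'), (ang (nu + 3) j'); split; [trivial | split].
- apply Rle_trans with (INR d * PI / INR (nu + 2)).
  + apply ang_dist with m; trivial; lia.
  + apply step_le; lia.
- apply Rle_trans with (INR d * PI / INR (nu + 3)).
  + apply ang_dist with j; trivial; lia.
  + apply step_le; lia.
Qed.

(** Every cell has two opposite vertices with odd index sum. At least one lies off the boundary of
    the grid, except in two corner cells: the one at the origin and one selected by the parity of
    [nu]. *)
Lemma MP_cell nu m j :
  (0 < nu)%nat -> (m <= nu + 1)%nat -> (j <= nu + 2)%nat ->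
  (exists m' j', (m <= m' <= m + 1)%nat /\ (j <= j' <= j + 1)%nat /\
     In (cos (ang (nu + 2) m'), cos (ang (nu + 3) j')) (MP nu)) \/
  (m = 0 /\ j = 0)%nat \/ (m = nu + 1 /\ j = 0 /\ Nat.Even nu)%nat \/
  (m = 0 /\ j = nu + 2 /\ Nat.Odd nu)%nat.
Proof.
intros Hnu Hm Hj.
assert (vertex : forall m' j', (m <= m' <= m + 1)%nat -> (j <= j' <= j + 1)%nat ->
  (1 <= m' <= nu + 1)%nat -> (1 <= j' <= nu + 2)%nat -> Nat.Odd (m' + j') ->
  exists m' j', (m <= m' <= m + 1)%nat /\ (j <= j' <= j + 1)%nat /\
     In (cos (ang (nu + 2) m'), cos (ang (nu + 3) j')) (MP nu)).
{ intros m' j' H1 H2 H3 H4 H5; exists m', j'; auto using in_MP. }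
destruct (Nat.Even_or_Odd (m + j)) as [[q Hq]|[q Hq]].
- destruct (le_lt_dec m nu), (le_lt_dec 1 j).
  1: left; apply (vertex (m + 1) j)%nat; try lia; exists q; lia.
  all: destruct (le_lt_dec 1 m), (le_lt_dec j (nu + 1)); try lia.
  all: left; apply (vertex m (j + 1))%nat; try lia; exists q; lia.
- destruct (le_lt_dec 1 m), (le_lt_dec 1 j).
  1: left; apply (vertex m j)%nat; try lia; exists q; lia.
  all: destruct (le_lt_dec m nu), (le_lt_dec j (nu + 1)); try lia.
  all: try (left; apply (vertex (m + 1) (j + 1))%nat; try lia; exists (q + 1)%nat; lia).
  + right; right; left; repeat split; try lia.
    exists (q - j)%nat; lia.
  + right; right; right; repeat split; try lia.
    exists (q - 1)%nat; lia.
Qed.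

Lemma ang_0 N : ang N 0 = 0.
Proof. unfold ang, Rdiv; simpl; ring. Qed.

Lemma ang_diag N : (0 < N)%nat -> ang N N = PI.
Proof. intros HN; unfold ang; field; apply not_0_INR; lia. Qed.

Lemma ang_1 N : ang N 1 = PI / INR N.
Proof. unfold ang; simpl; now rewrite Rmult_1_l. Qed.

(** The two added points are the outer vertices of the exceptional cells, that is, corners of the
    square. *)
Lemma A_set_covering nu : (0 < nu)%nat -> angle_covering (PI / INR nu) (A_set nu).
Proof.
intros Hnu; replace PI with (INR 1 * PI) by (simpl; ring).
apply angle_covering_grid; [trivial | lia |]; intros m j Hm Hj.
assert (Hin : forall z, In z (MP nu) \/ In z [(1, 1); if Nat.even nu then (-1, 1) else (1, -1)] ->
          In z (A_set nu)).
{ intros z Hz; unfold A_set; destruct (Nat.even nu); now apply in_or_app. }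
destruct (MP_cell nu m j Hnu Hm Hj) as
  [[m' [j' [H1 [H2 H3]]]] | [[-> ->] | [[-> [-> Hpar]] | [-> [-> Hpar]]]]].
- exists m', j'; split; [lia | split; [lia | auto]].
- exists 0%nat, 0%nat; split; [lia | split; [lia |]].
  apply Hin; rewrite !ang_0, cos_0; simpl; auto.
- exists (nu + 2)%nat, 0%nat; split; [lia | split; [lia |]].
  apply Nat.even_spec in Hpar; rewrite Hpar in Hin.
  apply Hin; rewrite ang_0, ang_diag, cos_0, cos_PI by lia; simpl; auto.
- exists 0%nat, (nu + 3)%nat; split; [lia | split; [lia |]].
  apply Nat.odd_spec in Hpar; rewrite <- Nat.negb_even in Hpar.
  apply Bool.negb_true_iff in Hpar; rewrite Hpar in Hin.
  apply Hin; rewrite ang_0, ang_diag, cos_0, cos_PI by lia; simpl; auto.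
Qed.

(** Here the added points are the inner vertices of the exceptional cells. *)
Lemma B_set_covering nu : (0 < nu)%nat -> angle_covering (PI / INR nu) (B_set nu).
Proof.
intros Hnu; replace PI with (INR 1 * PI) by (simpl; ring).
apply angle_covering_grid; [trivial | lia |]; intros m j Hm Hj.
assert (Hin : forall z, In z (MP nu) \/
    In z [(cos (ang (nu + 2) 1), cos (ang (nu + 3) 1));
          if Nat.even nu then (cos (ang (nu + 2) (nu + 1)), cos (ang (nu + 3) 1))
          else (cos (ang (nu + 2) 1), cos (ang (nu + 3) (nu + 2)))] ->
    In z (B_set nu)).
{ intros z Hz; rewrite !ang_1 in Hz; unfold B_set.
  destruct (Nat.even nu); now apply in_or_app. }
destruct (MP_cell nu m j Hnu Hm Hj) as
  [[m' [j' [H1 [H2 H3]]]] | [[-> ->] | [[-> [-> Hpar]] | [-> [-> Hpar]]]]].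
- exists m', j'; split; [lia | split; [lia | auto]].
- exists 1%nat, 1%nat; split; [lia | split; [lia |]].
  apply Hin; simpl; auto.
- exists (nu + 1)%nat, 1%nat; split; [lia | split; [lia |]].
  apply Nat.even_spec in Hpar; rewrite Hpar in Hin; apply Hin; simpl; auto.
- exists 1%nat, (nu + 2)%nat; split; [lia | split; [lia |]].
  apply Nat.odd_spec in Hpar; rewrite <- Nat.negb_even in Hpar.
  apply Bool.negb_true_iff in Hpar; rewrite Hpar in Hin; apply Hin; simpl; auto.
Qed.

(** Without added points, an exceptional cell uses the mesh point one step beyond its inner vertex
    in the second angle, hence the doubled radius. *)
Lemma MP_covering nu : (0 < nu)%nat -> angle_covering (2 * PI / INR nu) (MP nu).
Proof.
intros Hnu; change 2 with (INR 2).
apply angle_covering_grid; [trivial | lia |]; intros m j Hm Hj.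
destruct (MP_cell nu m j Hnu Hm Hj) as
  [[m' [j' [H1 [H2 H3]]]] | [[-> ->] | [[-> [-> [q Hq]]] | [-> [-> [q Hq]]]]]].
- exists m', j'; split; [lia | split; [lia | trivial]].
- exists 1%nat, 2%nat; split; [lia | split; [lia |]].
  apply in_MP; [lia | lia | exists 1%nat; lia].
- exists (nu + 1)%nat, 2%nat; split; [lia | split; [lia |]].
  apply in_MP; [lia | lia | exists (q + 1)%nat; lia].
- exists 1%nat, (nu + 1)%nat; split; [lia | split; [lia |]].
  apply in_MP; [lia | lia | exists (q + 1)%nat; lia].
Qed.

(** * Mesh sizes and conclusion *)

Lemma ceilN_ge x : 0 <= x -> x <= INR (ceilN x).
Proof.
intros Hx; destruct (base_Int_part (- x)) as [H _].
assert (Hc : x <= IZR (ceilZ x)) by (unfold ceilZ; rewrite opp_IZR; lra).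
unfold ceilN; rewrite INR_IZR_INZ, Z2Nat.id; trivial.
apply le_IZR; lra.
Qed.

Lemma angle_covering_le delta delta' L :
  delta <= delta' -> angle_covering delta L -> angle_covering delta' L.
Proof.
intros H HL a b Ha Hb; destruct (HL a b Ha Hb) as [a' [b' [Hin [H1 H2]]]].
exists a', b'; split; [trivial | lra].
Qed.

Lemma envelope_mesh_bound n mu f :
  (0 < n)%nat -> 2 < mu -> poly_envelope n f ->
  (exists B, forall z, inQ z -> f z <= B) ->
  forall z, inQ z ->
    f z <= / cos (PI / mu) *
      Rmin (norm_on (A_set (ceilN (mu * INR n))) f)
        (Rmin (norm_on (B_set (ceilN (mu * INR n))) f)
              (norm_on (MP (ceilN (2 * mu * INR n))) f)).
Proof.
intros Hn Hmu Hf HB z Hz.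
assert (HPI := PI_RGT_0).
assert (Hn' : 0 < INR n) by now apply lt_0_INR.
assert (Hmn : 0 < mu * INR n) by nra.
(* A common radius for the three meshes: the doubled radius of [MP] is offset by its doubled index.
   [mu > 2] keeps [n delta] below [PI / 2]. *)
set (delta := PI / (mu * INR n)).
assert (E : INR n * delta = PI / mu) by (unfold delta; field; lra).
assert (bound : forall L, angle_covering delta L -> f z <= / cos (PI / mu) * norm_on L f).
{ intros L HL; rewrite <- E; apply (angle_covering_bound n f delta L); trivial.
  - left; now apply Rdiv_lt_0_compat.
  - rewrite E; apply Rmult_lt_compat_l; [trivial|].
    apply Rinv_lt_contravar; lra. }
assert (size : forall k x, 0 < k -> 0 < x ->
          (0 < ceilN (k * x))%nat /\ k * PI / INR (ceilN (k * x)) <= PI / x).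
{ intros k x Hk Hx; assert (Hkx : 0 < k * x) by now apply Rmult_lt_0_compat.
  assert (Hc := ceilN_ge (k * x) ltac:(lra)); split; [apply INR_lt; simpl; lra|].
  replace (PI / x) with (k * PI / (k * x)) by (field; lra).
  apply Rmult_le_compat_l; [nra | now apply Rinv_le_contravar]. }
destruct (size 1 (mu * INR n)) as [S1 S1']; try lra; rewrite !Rmult_1_l in *.
destruct (size 2 (mu * INR n)) as [S2 S2']; try lra; rewrite <- Rmult_assoc in *.
(* The minimum equals one of its arguments, so a bound by each norm separately suffices. *)
apply Rmin_case; [|apply Rmin_case]; apply bound.
- apply angle_covering_le with (1 := S1'); now apply A_set_covering.
- apply angle_covering_le with (1 := S1'); now apply B_set_covering.
- apply angle_covering_le with (1 := S2'); now apply MP_covering.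
Qed.

Lemma sum_abs_envelope n (l : nat -> pt -> R) I :
  (forall i, In i I -> poly2 n (l i)) ->
  let f z := fold_right Rplus 0 (map (fun i => Rabs (l i z)) I) in
  poly_envelope n f /\ exists B, forall z, inQ z -> f z <= B.
Proof.
induction I as [|i I IH]; intros Hl f.
- split; [apply poly_envelope_zero | exists 0; intros; apply Rle_refl].
- destruct IH as [Henv [B HB]]; [intros; apply Hl; now right|].
  assert (Hi := Hl i (or_introl eq_refl)); split.
  + now apply poly_envelope_add_abs.
  + destruct (poly2_bounded n (l i) Hi) as [B' HB'].
    exists (B' + B); intros z Hz; now apply Rplus_le_compat; [apply HB' | apply HB].
Qed.

Theorem theorem6 (n : nat) (mu : R) :
  (0 < n)%nat -> 2 < mu ->
  (forall p : pt -> R, poly2 n p ->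
     forall z, inQ z ->
       Rabs (p z) <= / cos (PI / mu) *
         Rmin (norm_on (A_set (ceilN (mu * INR n))) p)
           (Rmin (norm_on (B_set (ceilN (mu * INR n))) p)
                 (norm_on (MP (ceilN (2 * mu * INR n))) p)))
  /\
  (forall (S : list pt) (l : nat -> pt -> R),
     (forall s, In s S -> inQ s) -> unisolvent n S -> lagrange_basis n S l ->
     forall z, inQ z ->
       lebesgue_fun S l z <= / cos (PI / mu) *
         Rmin (norm_on (A_set (ceilN (mu * INR n))) (lebesgue_fun S l))
           (Rmin (norm_on (B_set (ceilN (mu * INR n))) (lebesgue_fun S l))
                 (norm_on (MP (ceilN (2 * mu * INR n))) (lebesgue_fun S l)))).
Proof.
intros Hn Hmu; split.
- intros p Hp z Hz.
  (* [|p|] is treated as a sum of absolute values with one term. *)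
  destruct (sum_abs_envelope n (fun _ => p) [0%nat]) as [Henv HB]; [now intros|].
  assert (H := envelope_mesh_bound n mu _ Hn Hmu Henv HB z Hz).
  assert (norm_abs : forall L,
    norm_on L (fun z => fold_right Rplus 0 (map (fun _ => Rabs (p z)) [0%nat])) = norm_on L p).
  { intros L; unfold norm_on; f_equal; apply map_ext; intros z'; simpl.
    now rewrite Rplus_0_r, Rabs_Rabsolu. }
  rewrite !norm_abs in H; simpl in H; now rewrite Rplus_0_r in H.
- intros S l _ _ [Hl _] z Hz.
  destruct (sum_abs_envelope n l (seq 0 (length S))) as [Henv HB].
  { intros i Hi; apply Hl; apply in_seq in Hi; lia. }
  now apply (envelope_mesh_bound n mu (lebesgue_fun S l)).
Qed.
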